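(* There exists a constant $M\in\mathbb{N}$ such that for every almost Gorenstein monomial curve $\mathcal{C}\subseteq\mathbb{A}^5$ (of embedding dimension five, over any field), the Cohen-Macaulay type satisfies $t(\mathcal{C})\le M$.
   Context: A numerical semigroup is a submonoid $\mathcal{S}$ of $(\mathbb{N},+)$ (with $0\in\mathbb{N}$) such that $\mathbb{N}\setminus\mathcal{S}$ is finite. It has a unique minimal system of generators $\{g_1,\ldots,g_e\}$, and one writes $\mathcal{S}=\langle g_1,\ldots,g_e\rangle$; the integer $e$ is its embedding dimension. A monomial curve $\mathcal{C}\subseteq\mathbb{A}^5$ of embedding dimension five is the curve parametrized by $x_i=t^{g_i}$, $i=1,\ldots,5$, over a field $k$, where $\{g_1,\ldots,g_5\}$ is the minimal system of generators of a numerical semigroup $\mathcal{S}$ of embedding dimension five (the semigroup associated to $\mathcal{C}$). Its associated (complete) local ring is $R=k[[t^{g_1},\ldots,t^{g_5}]]$, a one-dimensional Cohen-Macaulay local domain with maximal ideal $\mathfrak{m}$ and integral closure $\overline{R}=k[[t]]$. The Cohen-Macaulay type $t(\mathcal{C})$ is the Cohen-Macaulay type of $R$. The curve $\mathcal{C}$ is almost Gorenstein if $R$ is almost Gorenstein in the sense of Barucci and Fröberg: $\mathfrak{m}\,\omega\subseteq\mathfrak{m}$, where $\omega$ is the canonical fractional ideal of $R$ with $R\subseteq\omega\subseteq\overline{R}$. Known correspondence with numerical semigroups: let $F(\mathcal{S})=\max(\mathbb{Z}\setminus\mathcal{S})$ be the Frobenius number, let $PF(\mathcal{S})$ be the set of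 integers $f\notin\mathcal{S}$ with $f+g_i\in\mathcal{S}$ for every $i$ (the pseudo-Frobenius numbers), and let $t(\mathcal{S})=|PF(\mathcal{S})|$ be the type of $\mathcal{S}$. Call $\mathcal{S}$ almost symmetric if for every integer $x\notin\mathcal{S}$ either $F(\mathcal{S})-x\in\mathcal{S}$ or $\{x,F(\mathcal{S})-x\}\subseteq PF(\mathcal{S})$. Then $\mathcal{C}$ is almost Gorenstein if and only if $\mathcal{S}$ is almost symmetric, and $t(\mathcal{C})=t(\mathcal{S})$. In these terms the claim says that the type of an almost symmetric numerical semigroup of embedding dimension five is bounded by an absolute constant. *)

(* Defs.v *)
From HB Require Import structures.
From mathcomp Require Import all_boot all_order all_algebra.
From mathcomp Require Import boolp classical_sets functions cardinality.

Set Implicit Arguments.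
Unset Strict Implicit.
Unset Printing Implicit Defensive.

Import GRing.Theory.

Local Open Scope classical_set_scope.

(** * Numerical semigroups *)

Definition submonoid (S : set nat) : Prop :=
  S 0 /\ (forall a b, S a -> S b -> S (a + b)).

Definition numerical_semigroup (S : set nat) : Prop :=
  submonoid S /\ finite_set (~` S).

Definition generated (G : set nat) : set nat := smallest submonoid G.

Definition minimal_generators (S G : set nat) : Prop :=
  generated G = S /\
  (forall G', G' `<=` G -> generated G' = S -> G' = G).

(** A monomial curve [x_i = t ^ g_i] over a field [k] is given by [k] and the
    exponents [g]; injectivity of [g] makes the number [e] of exponents the
    embedding dimension of the semigroup. *)
Definition monomial_curve_exponents (e : nat) (g : 'I_e -> nat) : Prop :=
  injective g /\
  (exists S, numerical_semigroup S /\ minimal_generators S (range g)).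

Local Open Scope ring_scope.

(** * Formal power series in one variable *)

Record fps (k : fieldType) := Fps { fcoef : nat -> k }.

Section PowerSeries.
Variable k : fieldType.
Implicit Types f g h : fps k.

Lemma fpsP f g : fcoef f =1 fcoef g -> f = g.
Proof. by case: f g => [f] [g] /= /funext ->. Qed.

HB.instance Definition _ := gen_eqMixin (fps k).
HB.instance Definition _ := gen_choiceMixin (fps k).

Definition fps_zero : fps k := Fps (fun=> 0).
Definition fps_one : fps k := Fps (fun n => (n == 0%N)%:R).
Definition fps_opp f : fps k := Fps (fun n => - fcoef f n).
Definition fps_add f g : fps k := Fps (fun n => fcoef f n + fcoef g n).
Definition fps_mul f g : fps k :=
  Fps (fun n => \sum_(i < n.+1) fcoef f i * fcoef g (n - i)).

Fact fps_addA : associative fps_add.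
Proof. by move=> f g h; apply: fpsP => n /=; rewrite addrA. Qed.
Fact fps_addC : commutative fps_add.
Proof. by move=> f g; apply: fpsP => n /=; rewrite addrC. Qed.
Fact fps_add0 : left_id fps_zero fps_add.
Proof. by move=> f; apply: fpsP => n /=; rewrite add0r. Qed.
Fact fps_addN : left_inverse fps_zero fps_opp fps_add.
Proof. by move=> f; apply: fpsP => n /=; rewrite addNr. Qed.

HB.instance Definition _ :=
  GRing.isZmodule.Build (fps k) fps_addA fps_addC fps_add0 fps_addN.

Definition fps_trunc n f : {poly k} := \poly_(i < n.+1) fcoef f i.

Lemma coef_fps_trunc n f i : (i <= n)%N -> (fps_trunc n f)`_i = fcoef f i.
Proof. by move=> le_in; rewrite coef_poly ltnS le_in. Qed.

Lemma fcoef_mul f g (p q : {poly k}) n :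
    (forall i, (i <= n)%N -> p`_i = fcoef f i) ->
    (forall i, (i <= n)%N -> q`_i = fcoef g i) ->
  forall i, (i <= n)%N -> (p * q)`_i = fcoef (fps_mul f g) i.
Proof.
move=> pf qg i le_in; rewrite coefM /=; apply: eq_bigr => j _.
have le_ji : (j <= i)%N by rewrite -ltnS.
by rewrite pf ?(leq_trans le_ji) // qg // (leq_trans (leq_subr _ _)).
Qed.

Fact fps_mulA : associative fps_mul.
Proof.
move=> f g h; apply: fpsP => n.
pose T := fps_trunc n.
have TP u i : (i <= n)%N -> (T u)`_i = fcoef u i by apply: coef_fps_trunc.
rewrite -(fcoef_mul (TP f) (fcoef_mul (TP g) (TP h)) (leqnn n)).
by rewrite -(fcoef_mul (fcoef_mul (TP f) (TP g)) (TP h) (leqnn n)) mulrA.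
Qed.

Fact fps_mulC : commutative fps_mul.
Proof.
move=> f g; apply: fpsP => n; pose T := fps_trunc n.
have TP u i : (i <= n)%N -> (T u)`_i = fcoef u i by apply: coef_fps_trunc.
rewrite -(fcoef_mul (TP f) (TP g) (leqnn n)).
by rewrite -(fcoef_mul (TP g) (TP f) (leqnn n)) mulrC.
Qed.

Fact fps_mul1 : left_id fps_one fps_mul.
Proof.
move=> f; apply: fpsP => n /=; rewrite big_ord_recl /= mul1r subn0.
by rewrite big1 ?addr0 // => i _; rewrite mul0r.
Qed.

Fact fps_mulDl : left_distributive fps_mul fps_add.
Proof.
move=> f g h; apply: fpsP => n /=; rewrite -big_split /=.
by apply: eq_bigr => i _; rewrite mulrDl.
Qed.

Fact fps_one_neq0 : fps_one != fps_zero.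
Proof.
by apply/eqP => /(congr1 (fun f => fcoef f 0%N)) /= /eqP; rewrite oner_eq0.
Qed.

HB.instance Definition _ := GRing.Zmodule_isComNzRing.Build (fps k)
  fps_mulA fps_mulC fps_mul1 fps_mulDl fps_one_neq0.

Definition fps_unit : {pred fps k} := fun f => `[< exists g, g * f = 1 >].

Definition fps_inv f : fps k :=
  if pselect (exists g, g * f = 1) is left ex_g then projT1 (cid ex_g) else f.

Fact fps_mulV : {in fps_unit, left_inverse 1 fps_inv *%R}.
Proof.
move=> f /asboolP ex_g; rewrite /fps_inv; case: pselect => // ex_g'.
exact: projT2 (cid ex_g').
Qed.

Fact fps_unitP f g : g * f = 1 -> fps_unit f.
Proof. by move=> gf1; apply/asboolP; exists g. Qed.

Fact fps_inv_out : {in [predC fps_unit], fps_inv =1 id}.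
Proof.
move=> f; rewrite inE /= => /asboolP nex_g.
by rewrite /fps_inv; case: pselect.
Qed.

HB.instance Definition _ := GRing.ComNzRing_hasMulInverse.Build (fps k)
  fps_mulV fps_unitP fps_inv_out.

Lemma fps_ord f :
  f <> 0 -> exists2 n, fcoef f n != 0 & forall i, (i < n)%N -> fcoef f i = 0.
Proof.
move=> nz_f; have ex_n : exists n, fcoef f n != 0.
  apply: contrapT => nex_n; apply: nz_f; apply: fpsP => n /=.
  by apply/eqP; apply: contrapT => /negP fn; apply: nex_n; exists n.
case: (ex_minnP ex_n) => n fn min_n; exists n => // i lt_in.
by apply/eqP; apply: contraTT lt_in => /min_n; rewrite -leqNgt.
Qed.

Fact fps_integral (f g : fps k) : f * g = 0 -> (f == 0) || (g == 0).
Proof.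
move=> fg0; case: (eqVneq f 0) => //= /eqP /fps_ord [m fm minf].
apply: contrapT => /negP/eqP /fps_ord [n gn ming].
have := congr1 (fun h => fcoef h (m + n)%N) fg0 => /=.
have lt_m : (m < (m + n).+1)%N by rewrite ltnS leq_addr.
rewrite (bigD1 (Ordinal lt_m)) //= addKn big1 => [|i].
  by rewrite addr0 => /eqP; rewrite mulf_eq0 (negPf fm) (negPf gn).
rewrite -val_eqE /= neq_ltn => /orP[/minf->|lt_mi]; first by rewrite mul0r.
rewrite [X in _ * X]ming ?mulr0 // ltn_subLR; last by rewrite -ltnS.
by rewrite ltn_add2r.
Qed.

HB.instance Definition _ :=
  GRing.ComUnitRing_isIntegral.Build (fps k) fps_integral.

End PowerSeries.

(** * Subrings of a field and their fractional ideals

    [R] is (the underlying set of) a local domain with fraction field [Q]. *)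

Section FractionalIdeals.
Variable Q : fieldType.
Implicit Types R I J V W : set Q.

Definition nonunits R : set Q :=
  [set x | R x /\ ~ (exists2 y, R y & x * y = 1)].

Definition submodule R I : Prop :=
  [/\ I 0, (forall x y, I x -> I y -> I (x + y))
         & (forall r x, R r -> I x -> I (r * x))].

Definition fractional_ideal R I : Prop :=
  [/\ submodule R I, (exists2 x, I x & x != 0)
    & (exists2 d, R d /\ d != 0 & forall x, I x -> R (d * x))].

Definition colon I J : set Q := [set x | forall y, J y -> I (x * y)].

Definition canonical_ideal R I : Prop :=
  fractional_ideal R I /\
  (forall J, fractional_ideal R J -> colon I (colon I J) = J).

(** For a one-dimensional analytically unramified local ring [R] with integral
    closure [Rbar], an ideal [I] as below exists, and whether
    [nonunits R * I] is contained in [nonunits R] does not depend on the choice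
    of [I]. *)
Definition almost_gorenstein R (Rbar : set Q) : Prop :=
  forall I, canonical_ideal R I -> R `<=` I -> I `<=` Rbar ->
  forall x y, nonunits R x -> I y -> nonunits R (x * y).

(** The quotient [V / W], where [nonunits R] maps [V] into [W], has dimension
    [n] over the residue field of [R]: the classes of the [v i] form a basis. *)
Definition residue_dim R V W (n : nat) : Prop :=
  exists v : 'I_n -> Q,
  [/\ forall i, V (v i),
      forall y, V y -> exists r : 'I_n -> Q,
        (forall i, R (r i)) /\ W (y - \sum_i r i * v i)
    & forall r : 'I_n -> Q, (forall i, R (r i)) ->
        W (\sum_i r i * v i) -> forall i, nonunits R (r i)].

Definition principal R (x : Q) : set Q := [set x * r | r in R].

(** Type of a one-dimensional Cohen-Macaulay local domain [R] with maximal
    ideal [m]: dimension of the socle [(xR :_R m) / xR] of [R / xR] for a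
    parameter [x]. As [R] is a domain, the parameters are the nonzero elements
    of [m]; the dimension is the same for all of them. *)
Definition cm_type R (n : nat) : Prop :=
  forall x, nonunits R x -> x != 0 ->
  residue_dim R (R `&` colon (principal R x) (nonunits R)) (principal R x) n.

End FractionalIdeals.

(** * The local ring of a monomial curve *)

(** The image of the power series [\sum_a c a * x ^ a] in [x_0, ..., x_(e-1)]
    under the substitution [x_i := t ^ g i]. As the [g i] are positive, an
    exponent vector [a] with [\sum_i a i * g i = n] has entries at most [n], so
    the sum is over all such [a]. *)
Definition fps_subst (k : fieldType) (e : nat) (g : 'I_e -> nat)
    (c : ('I_e -> nat) -> k) : fps k :=
  Fps (fun n =>
    \sum_(a : {ffun 'I_e -> 'I_n.+1} | (\sum_i a i * g i)%N == n)
       c (fun i => nat_of_ord (a i))).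

(** [k[[t ^ g 0, ..., t ^ g (e-1)]]] and [k[[t]]], inside [k((t))], which is the
    fraction field of both. *)
Definition curve_ring (k : fieldType) (e : nat) (g : 'I_e -> nat) :
    set {fraction fps k} :=
  [set FracField.tofrac (fps_subst g c) | c in [set: ('I_e -> nat) -> k]].

Definition fps_ring (k : fieldType) : set {fraction fps k} :=
  range (@FracField.tofrac (fps k)).
Arguments fps_ring k : clear implicits.
Arguments curve_ring k {e} g.

(* Main.v *)
Require Import Defs.
From mathcomp Require Import boolp classical_sets functions cardinality.
From mathcomp Require Import all_boot all_algebra.
From mathcomp Require Import zify.

(** Let [S] be the semigroup of the curve and [F] its Frobenius number. The
    local ring consists of the power series with exponents in [S]; the power
    series with exponents in [{n | F - n is not in S}] form a canonical ideal,
    because dividing by it is taking orthogonals for the pairing "coefficient of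
    [t ^ F] in the product". Almost Gorensteinness then says that [F - f] is
    pseudo-Frobenius whenever [f <> F] is, and the type is the number of
    pseudo-Frobenius numbers.

    To bound that number, write [f + g_i = \sum_j a_ij g_j] and
    [F - f + g_i = \sum_j b_ij g_j]. If [a_ij] and [b_ji] were both positive,
    [F] would lie in [S]. With too many [f]'s, Ramsey's theorem yields five of
    them along which every entry is constant or strictly monotone. Each row then
    has an increasing and a decreasing entry, since otherwise the difference of
    two of the [f]'s would lie in [S]. So [a] and [b] have at least 10 positive
    entries each; as the supports of [a] and of the transpose of [b] are
    disjoint among the 20 off-diagonal positions, all these counts are exact:
    two positive entries in each row and in each column of [a].
    If row [i] increases at [p_i] and decreases at [q_i], then [p_i = q_j]
    implies [q_i = p_j]. Hence mapping [i] to the other row with a positive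
    entry in column [p_i] is an involution of five points without fixed
    point. *)

Set Implicit Arguments.
Unset Strict Implicit.
Unset Printing Implicit Defensive.

Import GRing.Theory.

(** * Combinatorial tools *)

Section Ramsey.
Variables (T : eqType) (C : finType).
Implicit Types (s : seq T) (c : T -> T -> C).

Lemma pigeonhole_count (U : Type) (h : U -> C) n (s : seq U) :
  #|C| * n < size s -> exists col, n < count (fun x => h x == col) s.
Proof.
move=> lt_s; have size_s : size s = \sum_(col : C) count (fun x => h x == col) s.
  elim: s {lt_s} => [|x s IHs] /=; first by rewrite big1.
  rewrite big_split /= -IHs (bigD1 (h x)) //= eqxx big1 // => d /negPf.
  by rewrite eq_sym => ->.
apply/existsP; apply: contraLR lt_s => /existsPn no_col.
rewrite -leqNgt size_s -sum_nat_const leq_sum // => d _.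
by rewrite leqNgt no_col.
Qed.

(** Each chosen element records the colour of all its pairs with later ones: keep the head and
    continue inside a large colour class of the tail. *)
Lemma ramsey_prehomogeneous m : exists n, forall c s, n < size s ->
  exists w : seq (T * C), [/\ subseq (map fst w) s, size w = m
    & pairwise (fun u v => c u.1 v.1 == u.2) w].
Proof.
elim: m => [|m [n IHm]]; first by exists 0 => c s _; exists [::]; rewrite sub0seq.
exists (#|C| * n).+1 => c [//|x s]; rewrite ltnS => /(pigeonhole_count (c x))[col].
rewrite -size_filter => /(IHm c)[w [sub_w size_w pair_w]].
exists ((x, col) :: w); split; rewrite /= ?size_w ?eqxx ?pair_w ?andbT //.
  exact: subseq_trans sub_w (filter_subseq _ _).
by rewrite subseq_filter all_map in sub_w; case/andP: sub_w.
Qed.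

Lemma ramsey m : exists n, forall c s, n < size s ->
  exists2 s', subseq s' s
    & size s' = m /\ exists col, pairwise (fun x y => c x y == col) s'.
Proof.
have [n ramsey_n] := ramsey_prehomogeneous (#|C| * m).+1.
exists n => c s /(ramsey_n c)[w [sub_w size_w pair_w]].
have [|col] := @pigeonhole_count _ snd m w; first by rewrite size_w.
rewrite -size_filter => lt_m; set v := filter _ w in lt_m.
exists (take m (map fst v)).
  apply: subseq_trans (take_subseq _ _) (subseq_trans _ sub_w).
  exact/map_subseq/filter_subseq.
split; first by rewrite size_takel // size_map ltnW.
exists col; apply: subseq_pairwise (take_subseq _ _) _.
rewrite pairwise_map; apply: sub_in_pairwise (filter_all _ w) (pairwise_filter _ pair_w).
by move=> x y /= /eqP-> _.
Qed.

End Ramsey.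

(** Without fixed points, [phi] would swap the elements ranked below their image with the others,
    making the cardinality even. *)
Lemma odd_involution_fixpoint (T : finType) (phi : T -> T) :
  involutive phi -> odd #|T| -> exists x, phi x = x.
Proof.
move=> phiK; have [x /eqP fix_x _|/= no_fix] := pickP (fun x => phi x == x).
  by exists x.
pose A := [set x | enum_rank x < enum_rank (phi x)].
have imA : phi @: A = ~: A.
  apply/setP=> x; rewrite -[x]phiK mem_imset; last exact: can_inj phiK.
  rewrite !inE phiK -leqNgt ltn_neqAle val_eqE (inj_eq enum_rank_inj).
  by rewrite no_fix.
rewrite -(cardsC A) -imA card_imset; last exact: can_inj phiK.
by rewrite addnn odd_double.
Qed.

(** * Factorizations over the generators *)

Section Combinations.
Variables (e : nat) (g : 'I_e -> nat).
Implicit Types (a : 'I_e -> nat) (n s : nat) (i j : 'I_e).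

Definition combination a : nat := \sum_i a i * g i.

Definition semigroup n : Prop := exists a, n = combination a.

Definition pseudo_frobenius n : Prop :=
  ~ semigroup n /\ forall s, semigroup s -> s <> 0 -> semigroup (n + s).

Lemma combinationD a b :
  combination (fun i => a i + b i) = combination a + combination b.
Proof. by rewrite -big_split; apply: eq_bigr => i _; rewrite mulnDl. Qed.

Lemma semigroup0 : semigroup 0.
Proof. by exists (fun=> 0); rewrite /combination big1. Qed.

Lemma semigroupD m n : semigroup m -> semigroup n -> semigroup (m + n).
Proof. by move=> [a ->] [b ->]; rewrite -combinationD; eexists. Qed.

Lemma semigroup_gen i : semigroup (g i).
Proof.
exists (fun j => j == i : nat).
by rewrite /combination (bigD1 i) //= eqxx mul1n big1 ?addn0 // => j /negPf->.
Qed.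

Lemma semigroupM k n : semigroup n -> semigroup (k * n).
Proof.
move=> Sn; elim: k => [|k IHk]; first exact: semigroup0.
by rewrite mulSn; apply: semigroupD.
Qed.

Lemma combination_split a i : 0 < a i ->
  exists2 s, semigroup s & combination a = g i + s.
Proof.
move=> ai_gt0; exists (combination (fun j => if j == i then (a i).-1 else a j)).
  by eexists.
rewrite /combination (bigD1 i) //= [in RHS](bigD1 i) //= eqxx addnA.
rewrite -mulSn prednK //; congr addn.
by apply: eq_bigr => j /negPf->.
Qed.

Lemma factorization_exists : exists fac : nat -> 'I_e -> nat,
  forall n, semigroup n -> n = combination (fac n).
Proof.
suff /boolp.choice[fac] : forall n, exists a, semigroup n -> n = combination a.
  by exists fac.
move=> n; have [[a na]|nSn] := pselect (semigroup n); first by exists a.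
by exists (fun=> 0) => /nSn.
Qed.

End Combinations.

Section Rows.
Variables (e : nat) (g : 'I_e -> nat).
Local Notation S := (semigroup g).

Lemma combination_le (a b : 'I_e -> nat) : (forall i, a i <= b i) ->
  combination g b = combination g a + combination g (fun i => b i - a i).
Proof.
by move=> le_ab; rewrite -combinationD; apply: eq_bigr => i _; rewrite subnKC.
Qed.

(** If no coefficient grew, [u'] would not exceed [u]; if none dropped, [u' - u] would be a nonzero
    element of the semigroup, and so [u'] would lie in it. *)
Lemma factorization_shift (u u' w : nat) (a a' : 'I_e -> nat) :
    pseudo_frobenius g u -> ~ S u' -> u < u' ->
    u + w = combination g a -> u' + w = combination g a' ->
  (exists p, a p < a' p) /\ (exists q, a' q < a q).
Proof.
move=> [_ PFu] nSu' lt_u def_a def_a'.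
have [p lt_p|/= le_a] := pickP (fun p => a p < a' p); last first.
  have := @combination_le a' a (fun i => etrans (leqNgt _ _) (negbT (le_a i))).
  lia.
have [q lt_q|/= le_a'] := pickP (fun q => a' q < a q); first by split; [exists p | exists q].
have eq_a' := @combination_le a a' (fun i => etrans (leqNgt _ _) (negbT (le_a' i))).
case: nSu'; have -> : u' = u + combination g (fun i => a' i - a i) by lia.
by apply: PFu; [eexists | lia].
Qed.

End Rows.

(** * Double counting of two supports *)

Section TransposedSupports.
Variables E E' : rel 'I_5.
Hypothesis E_irrefl : forall i, E i i = false.
Hypothesis E'_irrefl : forall i, E' i i = false.
Hypothesis E_E' : forall i j, E i j -> E' j i = false.
Hypothesis E_ge2 : forall i, 1 < #|E i|.
Hypothesis E'_ge2 : forall i, 1 < #|E' i|.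

(** Column [j] of [E] and row [j] of [E'] are disjoint in four off-diagonal places. So columns of
    [E] have at most two entries, rows at least two, and the total 10 forces equality everywhere. *)
Lemma transposed_supports_card :
  [/\ forall i, #|E i| = 2, forall j, #|[pred i | E i j]| = 2
    & forall i j, i != j -> E i j || E' j i].
Proof.
have col_le j : #|[pred i | E i j]| + #|E' j| <= 4 ?= iff
    [forall i, (i != j) ==> E i j || E' j i].
  have -> : #|[pred i | E i j]| + #|E' j| = #|[predU [pred i | E i j] & E' j]|.
    rewrite -cardUI [X in _ + X]eq_card0 ?addn0 // => i; rewrite !inE.
    by apply/negP=> /andP[/E_E']; rewrite /in_mem /= => ->.
  have sub_j : {subset [predU [pred i | E i j] & E' j] <= predC1 j}.
    move=> i; rewrite !inE; apply: contraL => /eqP->.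
    by rewrite E_irrefl /in_mem /= E'_irrefl.
  have := subset_leqif_card (introT subsetP sub_j); rewrite cardC1 card_ord.
  congr (leqif _ _ _); apply/subsetP/forallP => [sub i|sub i].
    by apply/implyP=> /sub; rewrite !inE.
  by rewrite inE => ne_ij; have := implyP (sub i) ne_ij; rewrite !inE.
have sumE : \sum_i #|E i| = \sum_j #|[pred i | E i j]|.
  under eq_bigr do rewrite -sum1_card big_mkcond.
  rewrite exchange_big /=; apply: eq_bigr => j _.
  by rewrite -sum1_card [RHS]big_mkcond.
have row_ge i : 2 <= #|E i| ?= iff (2 == #|E i|) by apply: leqif_eq.
have col_le2 j : #|[pred i | E i j]| <= 2 ?= iff (#|[pred i | E i j]| == 2).
  by apply: leqif_eq; have := (col_le j).1; have := E'_ge2 j; lia.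
have := leqif_trans (leqif_sum (fun i (_ : true) => row_ge i)).
rewrite sumE => /(_ _ _ (leqif_sum (fun j (_ : true) => col_le2 j)))[_].
rewrite eqxx => /esym/andP[/forallP E2 /forallP c2].
have {}c2 j : #|[pred i | E i j]| = 2 by apply/eqP/(implyP (c2 j)).
split=> // [i|i j ne_ij]; first by have := E2 i => /= /eqP.
have := (col_le j); rewrite c2 => -[le4 eq4].
have /eqP: 2 + #|E' j| = 4 by have := E'_ge2 j; lia.
by rewrite eq4 => /forallP/(_ i)/implyP; apply.
Qed.

End TransposedSupports.

(* [alpha g_v = delta + beta g_q] and [delta + beta' g_v = alpha' g_p] give
   [(alpha + beta') g_v = alpha' g_p + beta g_q]; of the two consecutive steps,
   one is such that [g_v] has a coefficient at least [alpha + beta'] in row [i]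
   for the largest element or in row [j] for the smallest one. *)
Lemma exchange_relation (x y z gi gj gv gp gq : nat)
    (a1 a2 a3 b1 b2 b3 c1 c2 c3 d1 d2 d3 : nat) :
    x < y -> y < z -> a1 < a2 < a3 -> b3 < b2 < b1 -> c1 < c2 < c3 -> d3 < d2 < d1 ->
    x + gi = a1 * gv + b1 * gq -> y + gi = a2 * gv + b2 * gq ->
    z + gi = a3 * gv + b3 * gq ->
    x + gj = c1 * gp + d1 * gv -> y + gj = c2 * gp + d2 * gv ->
    z + gj = c3 * gp + d3 * gv ->
  (exists u v w, z + gi = gp + (u * gv + v * gp + w * gq)) \/
  (exists u v w, x + gj = gq + (u * gv + v * gp + w * gq)).
Proof.
move=> lt_xy lt_yz /andP[a12 a23] /andP[b32 b21] /andP[c12 c23] /andP[d32 d21].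
have [al1 ea2] : exists k, a2 = a1 + k by exists (a2 - a1); lia.
have [al2 ea3] : exists k, a3 = a2 + k by exists (a3 - a2); lia.
have [be2 eb2] : exists k, b2 = b3 + k.+1 by exists (b2 - b3).-1; lia.
have [be1 eb1] : exists k, b1 = b2 + k by exists (b1 - b2); lia.
have [ga1 ec2] : exists k, c2 = c1 + k.+1 by exists (c2 - c1).-1; lia.
have [ga2 ec3] : exists k, c3 = c2 + k by exists (c3 - c2); lia.
have [de2 ed2] : exists k, d2 = d3 + k by exists (d2 - d3); lia.
have [de1 ed1] : exists k, d1 = d2 + k by exists (d1 - d2); lia.
subst a2 a3 b2 b1 c2 c3 d2 d1.
(* [al2] is the rise of the [gv] coefficient in row [i] from [y] to [z], [de1] its drop in row [j]
   from [x] to [y]. The first case inserts the relation of the step [x], [y] at [z], the second that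
   of the step [y], [z] at [x]. *)
have [le_d|lt_d] := leqP de1 al2; [left | right].
  have [r er] : exists r, al2 = de1 + r by exists (al2 - de1); lia.
  by subst al2; exists (a1 + r), ga1, (b3 + be1); lia.
have [r er] : exists r, de1 = al2 + r by exists (de1 - al2); lia.
by subst de1; exists (d3 + r), (c1 + ga2), be2; lia.
Qed.

(** * Five pseudo-Frobenius numbers with a uniform monotonicity pattern *)

Section Core.
Variables (g : 'I_5 -> nat) (F : nat) (f : nat -> nat).
Variables (a b : nat -> 'I_5 -> 'I_5 -> nat) (inc dec inc' dec' : rel 'I_5).
Local Notation S := (semigroup g).
Hypothesis nSF : ~ S F.
Hypothesis f_lt : forall m n, m < n < 5 -> f m < f n.
Hypothesis f_le : forall n, n < 5 -> f n <= F.
Hypothesis PFf : forall n, n < 5 -> pseudo_frobenius g (f n).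
Hypothesis PFf' : forall n, n < 5 -> pseudo_frobenius g (F - f n).
Hypothesis aE : forall n i, n < 5 -> f n + g i = combination g (a n i).
Hypothesis bE : forall n i, n < 5 -> F - f n + g i = combination g (b n i).
Hypothesis a_inc : forall m n i j, m < n < 5 -> (a m i j < a n i j) = inc i j.
Hypothesis a_dec : forall m n i j, m < n < 5 -> (a n i j < a m i j) = dec i j.
Hypothesis b_inc : forall m n i j, m < n < 5 -> (b m i j < b n i j) = inc' i j.
Hypothesis b_dec : forall m n i j, m < n < 5 -> (b n i j < b m i j) = dec' i j.

Lemma inc_row i : exists p, inc i p.
Proof.
have lt01 : f 0 < f 1 by apply: f_lt.
have [[p]] := factorization_shift (PFf (isT : 0 < 5)) (PFf (isT : 1 < 5)).1 lt01
  (@aE 0 i isT) (@aE 1 i isT).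
by rewrite a_inc //; exists p.
Qed.

Lemma dec_row i : exists q, dec i q.
Proof.
have lt01 : f 0 < f 1 by apply: f_lt.
have [_ [q]] := factorization_shift (PFf (isT : 0 < 5)) (PFf (isT : 1 < 5)).1 lt01
  (@aE 0 i isT) (@aE 1 i isT).
by rewrite a_dec //; exists q.
Qed.

Lemma inc_dec'_row i : (exists p, inc' i p) /\ (exists q, dec' i q).
Proof.
have lt01 : F - f 1 < F - f 0.
  by have := f_lt (isT : 0 < 1 < 5); have := f_le (isT : 1 < 5); lia.
have [[q]] := factorization_shift (PFf' (isT : 1 < 5)) (PFf' (isT : 0 < 5)).1 lt01
  (@bE 1 i isT) (@bE 0 i isT).
by rewrite b_dec // => dec_q [p]; rewrite b_inc // => inc_p; split; [exists p | exists q].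
Qed.

(** Having an index on each side of [n] makes growing and dropping entries positive at [n]; this
    leaves three inner indices, as many as [exchange_relation] takes. *)
Lemma inc_pos n i j : 0 < n < 4 -> inc i j -> 0 < a n i j.
Proof. by move=> n_mid; rewrite -(@a_inc 0 n) //; lia. Qed.

Lemma dec_pos n i j : 0 < n < 4 -> dec i j -> 0 < a n i j.
Proof. by move=> n_mid; rewrite -(@a_dec n 4) //; lia. Qed.

Lemma inc_dec i j : inc i j -> dec i j -> False.
Proof. by rewrite -(@a_inc 0 1) // -(@a_dec 0 1) //; lia. Qed.

(** A positive [b n j i] gives [F - f n + g j = g i + s']; adding both equations yields
    [F = s + s']. *)
Lemma no_exchange n i j s : n < 5 -> S s -> f n + g i = g j + s -> b n j i = 0.
Proof.
move=> n_lt Ss f_s; apply/eqP; rewrite -leqn0 leqNgt; apply/negP.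
case/(combination_split g) => s' Ss'; rewrite -bE // => f'_s'.
case: nSF; have -> : F = s + s' by have := f_le n_lt; lia.
exact: semigroupD.
Qed.

Lemma row_supports n : 0 < n < 4 ->
  [/\ forall i, #|[pred j | 0 < a n i j]| = 2,
      forall j, #|[pred i | 0 < a n i j]| = 2
    & forall i j, i != j -> (0 < a n i j) || (0 < b n j i)].
Proof.
move=> n_mid; have n_lt : n < 5 by lia.
pose E i j := 0 < a n i j; pose E' i j := 0 < b n i j.
apply: (@transposed_supports_card E E') => [i|i|i j|i|i].
- apply/negP => /(combination_split g)[s Ss]; rewrite -aE // => f_s.
  by have [] := PFf n_lt; case; have -> : f n = s by lia.
- apply/negP => /(combination_split g)[s Ss]; rewrite -bE // => f_s.
  by have [] := PFf' n_lt; case; have -> : F - f n = s by lia.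
- move=> /(combination_split g)[s Ss]; rewrite -aE // => f_s.
  by rewrite /E' (no_exchange n_lt Ss f_s).
- have [p inc_p] := inc_row i; have [q dec_q] := dec_row i.
  have ne_pq : p != q.
    by apply/eqP => eq_pq; subst q; apply: inc_dec inc_p dec_q.
  have card_pq : #|pred2 p q| = 2 by rewrite card2 ne_pq.
  apply: leq_trans (eq_leq (esym card_pq)) (subset_leq_card _).
  apply/subsetP => j; rewrite !inE /in_mem /=.
  by case/orP=> /eqP->; [apply: inc_pos | apply: dec_pos].
- have [[p inc_p] [q dec_q]] := inc_dec'_row i.
  have ne_pq : p != q.
    apply/eqP => eq_pq; subst q; move: inc_p dec_q.
    by rewrite -(@b_inc 0 1) // -(@b_dec 0 1) //; lia.
  have card_pq : #|pred2 p q| = 2 by rewrite card2 ne_pq.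
  apply: leq_trans (eq_leq (esym card_pq)) (subset_leq_card _).
  apply/subsetP => j; rewrite !inE /in_mem /= /E'.
  case/orP=> /eqP->; [rewrite -(@b_inc 0 n) in inc_p|rewrite -(@b_dec n 4) in dec_q]; lia.
Qed.

(** The growing and the dropping entry exhaust the two-element support, which is thus the same at
    all inner indices. *)
Lemma rows_pair : exists p q : 'I_5 -> 'I_5, forall i,
  [/\ inc i (p i), dec i (q i), p i != q i
    & forall n j, 0 < n < 4 -> (0 < a n i j) = (j == p i) || (j == q i)].
Proof.
have [p inc_p] := fin_all_exists inc_row; have [q dec_q] := fin_all_exists dec_row.
exists p, q => i; have ne_pq : p i != q i.
  by apply/eqP => eq_pq; apply: (inc_dec (inc_p i)); rewrite eq_pq.
split=> // n j n_mid; have [row2 _ _] := row_supports n_mid.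
have sub_pq : pred2 (p i) (q i) \subset [pred j | 0 < a n i j].
  apply/subsetP => k; rewrite !inE.
  by case/orP=> /eqP->; [apply: inc_pos | apply: dec_pos].
have := subset_leqif_card sub_pq; rewrite card2 ne_pq row2 /= => -[_].
rewrite eqxx => /esym/subsetP/(_ j); rewrite !inE => a_sub.
apply/idP/idP => // pq_j; exact: (subsetP sub_pq).
Qed.

(** Although [a n i] is one chosen factorization, its support contains every generator occurring in
    any factorization of [f n + g i]: [b n j i] vanishes, and the count is exact. *)
Lemma row_forced n i j s : 0 < n < 4 -> S s -> f n + g i = g j + s -> 0 < a n i j.
Proof.
move=> n_mid Ss f_s; have n_lt : n < 5 by lia.
have [eq_ij | ne_ij] := eqVneq i j.
  by have [] := PFf n_lt; case; have -> : f n = s by rewrite eq_ij in f_s; lia.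
have [_ _ /(_ i j ne_ij)] := row_supports n_mid.
by rewrite (no_exchange n_lt Ss f_s) orbF.
Qed.

Lemma combination_pair (c : 'I_5 -> nat) p q : p != q ->
    (forall j, (0 < c j) = (j == p) || (j == q)) ->
  combination g c = c p * g p + c q * g q.
Proof.
move=> ne_pq supp_c; rewrite /combination (bigD1 p) //= (bigD1 q) 1?eq_sym //=.
rewrite big1 ?addn0 // => j /andP[/negPf nep /negPf neq].
by have := supp_c j; rewrite nep neq; case: (c j).
Qed.

(** Put [v = p i = q j]. If [q i] and [p j] differed, [exchange_relation] would give a factorization
    of [f 3 + g i] using [g (p j)] or one of [f 1 + g j] using [g (q i)]; [row_forced] excludes
    both. *)
Lemma pair_partner (p q : 'I_5 -> 'I_5) i j :
    (forall i, [/\ inc i (p i), dec i (q i), p i != q i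
      & forall n j, 0 < n < 4 -> (0 < a n i j) = (j == p i) || (j == q i)]) ->
  p i = q j -> q i = p j.
Proof.
move=> pq eq_v; have [inc_i dec_i ne_i supp_i] := pq i.
have [inc_j dec_j ne_j supp_j] := pq j.
have rowi n : 0 < n < 4 -> f n + g i = a n i (p i) * g (p i) + a n i (q i) * g (q i).
  move=> n_mid; have n_lt : n < 5 by lia.
  by rewrite aE // (@combination_pair _ (p i) (q i)) // => k; apply: supp_i.
have rowj n : 0 < n < 4 -> f n + g j = a n j (p j) * g (p j) + a n j (q j) * g (q j).
  move=> n_mid; have n_lt : n < 5 by lia.
  by rewrite aE // (@combination_pair _ (p j) (q j)) // => k; apply: supp_j.
rewrite -eq_v in dec_j ne_j supp_j rowj *.
have [//|ne_qp] := eqVneq (q i) (p j).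
have Spq v u w : S (v * g (p i) + u * g (p j) + w * g (q i)).
  by apply: semigroupD; first apply: semigroupD; apply: semigroupM; apply: semigroup_gen.
have gt_i m n : m < n < 5 -> a m i (p i) < a n i (p i) by move/a_inc->.
have lt_i m n : m < n < 5 -> a n i (q i) < a m i (q i) by move/a_dec->.
have gt_j m n : m < n < 5 -> a m j (p j) < a n j (p j) by move/a_inc->.
have lt_j m n : m < n < 5 -> a n j (p i) < a m j (p i) by move/a_dec->.
have := exchange_relation (f_lt (isT : 1 < 2 < 5)) (f_lt (isT : 2 < 3 < 5))
  _ _ _ _ (rowi 1 isT) (rowi 2 isT) (rowi 3 isT) (rowj 1 isT) (rowj 2 isT) (rowj 3 isT).
case; rewrite ?gt_i ?lt_i ?gt_j ?lt_j // => -[u [v [w f_s]]].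
  have := @row_forced 3 _ _ _ isT (Spq _ _ _) f_s.
  by rewrite supp_i // (negPf ne_j) eq_sym (negPf ne_qp).
have := @row_forced 1 _ _ _ isT (Spq _ _ _) f_s.
by rewrite supp_j // (negPf ne_qp) eq_sym (negPf ne_i).
Qed.

Lemma no_monotone_family : False.
Proof.
have [p [q pq]] := rows_pair.
have [_ col2 _] := @row_supports 1 isT.
have pq_supp i j : (0 < a 1 i j) = (j == p i) || (j == q i) by have [_ _ _ ->] := pq i.
(* Column [p i] has two positive entries, one of them in row [i]; [phi i] will be the row of the
   other. *)
have other i : exists k, k != i /\ forall l, (0 < a 1 l (p i)) = (l == i) || (l == k).
  have /eqP := col2 (p i); rewrite (cardD1 i) !inE pq_supp eqxx /= eqSS.
  move/eqP/mem_card1=> [k col_k]; exists k; have := col_k k.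
  rewrite !inE eqxx => /andP[ne_ki _]; split=> // l.
  have := col_k l; rewrite !inE; have [-> /= _|//] := eqVneq l i.
  by rewrite pq_supp eqxx.
have [phi phiP] := fin_all_exists other.
have [||i eq_i] := @odd_involution_fixpoint _ phi.
- move=> i; have [ne_i col_i] := phiP i; have [ne_k col_k] := phiP (phi i).
  (* This puts [i] in column [p (phi i)], so [phi (phi i) = i]. When [p i] is the dropping position
     of row [phi i], it comes from [pair_partner]. *)
  have : 0 < a 1 i (p (phi i)).
    have := col_i (phi i); rewrite eqxx orbT !pq_supp => /orP[/eqP->|/eqP eq_pq].
      by rewrite eqxx.
    by rewrite -(pair_partner pq eq_pq) eqxx orbT.
  by rewrite col_k eq_sym (negPf ne_i) => /eqP.
- by rewrite card_ord.
- by have [/eqP] := phiP i.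
Qed.

End Core.

(** [M] is a Ramsey number for five elements: the colour of a pair tells which entries of the
    row-factorization matrices of [x] and of [F - x] rise or fall. *)
Lemma almost_symmetric_type_bounded :
  exists M, forall (g : 'I_5 -> nat) (F : nat) (s : seq nat),
  (forall i, 0 < g i) -> ~ semigroup g F -> sorted ltn s ->
  (forall f, f \in s ->
     [/\ f <= F, pseudo_frobenius g f & pseudo_frobenius g (F - f)]) ->
  size s <= M.
Proof.
have [M ramseyM] :=
  @ramsey nat {ffun bool * 'I_5 * 'I_5 -> bool * bool} 5.
exists M => g F s g_gt0 nSF sorted_s PFs; rewrite leqNgt; apply/negP => lt_s.
have [fac facE] := factorization_exists g.
pose row (x : nat) (t : bool * 'I_5 * 'I_5) :=
  fac ((if t.1.1 then F - x else x) + g t.1.2) t.2.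
pose c x y := [ffun t => (row x t < row y t, row y t < row x t)].
have [s' sub_s' [size_s' [col pair_col]]] := ramseyM c s lt_s.
have pair_lt : pairwise ltn s'.
  by apply: subseq_pairwise sub_s' _; rewrite -(sorted_pairwise ltn_trans).
pose f := nth 0 s'.
have f_s n : n < 5 -> f n \in s.
  by move=> ?; apply/(mem_subseq sub_s')/mem_nth; rewrite size_s'.
have f_col m n t : m < n < 5 ->
    (row (f m) t < row (f n) t) = (col t).1 /\ (row (f n) t < row (f m) t) = (col t).2.
  move=> /andP[lt_mn lt_n].
  have /eqP <- : c (f m) (f n) == col.
    by apply: (pairwiseP 0 pair_col); rewrite ?inE ?size_s' //; apply: ltn_trans lt_n.
  by rewrite ffunE.
have PF_gen n i : pseudo_frobenius g n -> n + g i = combination g (fac (n + g i)).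
  case=> _ PFn; apply/facE/PFn; first exact: semigroup_gen.
  by apply/eqP; rewrite -lt0n.
apply: (@no_monotone_family g F f
  (fun n i j => row (f n) (false, i, j)) (fun n i j => row (f n) (true, i, j))
  (fun i j => (col (false, i, j)).1) (fun i j => (col (false, i, j)).2)
  (fun i j => (col (true, i, j)).1) (fun i j => (col (true, i, j)).2)) => //.
- move=> m n /andP[lt_mn lt_n].
  by apply: (pairwiseP 0 pair_lt); rewrite ?inE ?size_s' //; apply: ltn_trans lt_n.
- by move=> n /f_s/PFs[].
- by move=> n /f_s/PFs[].
- by move=> n /f_s/PFs[].
- by move=> n i /f_s/PFs[_ /PF_gen].
- by move=> n i /f_s/PFs[_ _ /PF_gen].
- by move=> m n i j /f_col-/(_ (false, i, j))[].
- by move=> m n i j /f_col-/(_ (false, i, j))[].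
- by move=> m n i j /f_col-/(_ (true, i, j))[].
- by move=> m n i j /f_col-/(_ (true, i, j))[].
Qed.

(** * Power series *)

Local Notation "x %:F" := (FracField.tofrac x).

Section PowerSeries.
Local Open Scope classical_set_scope.
Local Open Scope ring_scope.

Lemma frac_denom (R : idomainType) (x : {fraction R}) :
  exists u v : R, v != 0 /\ x * v%:F = u%:F.
Proof.
elim/generic_quotient.quotW: x => x; exists (frac x).1, (frac x).2.
split; first exact: denom_ratioP.
unlock FracField.tofrac; rewrite -[LHS]FracField.pi_mul; apply/eqP.
rewrite FracField.equivf_def /FracField.mulf !numden_Ratio ?oner_neq0 ?mulr1 ?denom_ratioP //.
by rewrite mulrC.
Qed.

Variable k : fieldType.
Implicit Types (h u w : fps k) (n m : nat).

Lemma fcoef0 n : fcoef (0 : fps k) n = 0. Proof. by []. Qed.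

Lemma fcoef1 n : fcoef (1 : fps k) n = (n == 0%N)%:R. Proof. by []. Qed.

Lemma fcoefD h u n : fcoef (h + u) n = fcoef h n + fcoef u n.
Proof. by []. Qed.

Lemma fcoefN h n : fcoef (- h) n = - fcoef h n. Proof. by []. Qed.

Lemma fcoefM h u n :
  fcoef (h * u) n = \sum_(i < n.+1) fcoef h i * fcoef u (n - i).
Proof. by []. Qed.

Lemma fcoef_sum (I : Type) (r : seq I) (P : pred I) (h : I -> fps k) n :
  fcoef (\sum_(i <- r | P i) h i) n = \sum_(i <- r | P i) fcoef (h i) n.
Proof. by elim/big_rec2: _ => // i x y _ <-. Qed.

Definition fpsX n : fps k := Fps (fun m => (m == n)%:R).

Definition fpsC (c : k) : fps k := Fps (fun m => if m == 0%N then c else 0).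

Lemma fcoef_Xmul n h m :
  fcoef (fpsX n * h) m = if (m < n)%N then 0 else fcoef h (m - n).
Proof.
rewrite fcoefM; case: ltnP => [lt_mn|le_nm].
  rewrite big1 // => i _ /=; rewrite ltn_eqF ?mul0r //.
  exact: leq_trans (ltn_ord i) lt_mn.
rewrite (bigD1 (Ordinal (le_nm : n < m.+1)%N)) //= eqxx mul1r.
rewrite big1 ?addr0 // => i; rewrite -val_eqE /= => /negPf->.
by rewrite mul0r.
Qed.

Lemma fcoef_Xmul_add n h m : fcoef (fpsX n * h) (n + m) = fcoef h m.
Proof. by rewrite fcoef_Xmul ltnNge leq_addr addKn. Qed.

Lemma fcoef_Xmul0 n h : fcoef (fpsX n * h) n = fcoef h 0%N.
Proof. by have := fcoef_Xmul_add n h 0; rewrite addn0. Qed.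

Lemma fcoef_Cmul c h m : fcoef (fpsC c * h) m = c * fcoef h m.
Proof.
by rewrite fcoefM big_ord_recl /= subn0 big1 ?addr0 // => i _; rewrite mul0r.
Qed.

Lemma fpsXD m n : fpsX (m + n) = fpsX m * fpsX n.
Proof.
apply: fpsP => i; rewrite fcoef_Xmul; case: ltnP => [lt_im|le_mi] /=.
  by rewrite ltn_eqF ?(leq_trans lt_im) ?leq_addr.
by rewrite -(eqn_add2l m (i - m)) subnKC.
Qed.

Lemma fpsX_neq0 n : fpsX n != 0.
Proof.
apply/eqP => /(congr1 (fun h => fcoef h n)) /= /eqP.
by rewrite eqxx oner_eq0.
Qed.

Lemma fpsX_dvd n h :
  (forall m, (m < n)%N -> fcoef h m = 0) -> exists u, h = fpsX n * u.
Proof.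
move=> h0; exists (Fps (fun m => fcoef h (n + m))); apply: fpsP => m.
by rewrite fcoef_Xmul; case: ltnP => [/h0|le_nm]; rewrite //= subnKC.
Qed.

Definition supported (A : set nat) h := forall n, fcoef h n != 0 -> A n.

Lemma supportedW (A B : set nat) h : A `<=` B -> supported A h -> supported B h.
Proof. by move=> AB Ah n /Ah/AB. Qed.

Lemma supportedD A h u : supported A h -> supported A u -> supported A (h + u).
Proof.
move=> Ah Au n; rewrite fcoefD; have [->|/Ah//] := eqVneq (fcoef h n) 0.
by rewrite add0r => /Au.
Qed.

Lemma supported0 A : supported A 0.
Proof. by move=> n; rewrite fcoef0 eqxx. Qed.

Lemma supportedN A h : supported A h -> supported A (- h).
Proof. by move=> Ah n; rewrite fcoefN oppr_eq0 => /Ah. Qed.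

Lemma supported_sum A (I : Type) (r : seq I) (P : pred I) (h : I -> fps k) :
  (forall i, P i -> supported A (h i)) -> supported A (\sum_(i <- r | P i) h i).
Proof.
move=> Ah; elim/big_ind: _ => //; [exact: supported0 | exact: supportedD].
Qed.

Lemma supportedX (A : set nat) n : A n -> supported A (fpsX n).
Proof. by move=> An m /=; case: (m =P n) => [->//|_]; rewrite eqxx. Qed.

Lemma supportedC (A : set nat) c : A 0 -> supported A (fpsC c).
Proof. by move=> A0 [|n] //=; rewrite eqxx. Qed.

Lemma fcoefM_neq0 h u n : fcoef (h * u) n != 0 ->
  exists i j, [/\ n = (i + j)%N, fcoef h i != 0 & fcoef u j != 0].
Proof.
rewrite fcoefM.
have [i nz_i _|/= z] := pickP (fun i : 'I_n.+1 => fcoef h i * fcoef u (n - i) != 0).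
  exists i, (n - i)%N; move: nz_i; rewrite mulf_eq0 negb_or => /andP[-> ->].
  by rewrite subnKC // -ltnS.
by rewrite big1 ?eqxx // => i _; apply/eqP; have := z i; case: eqP.
Qed.

Lemma supportedM (A B C : set nat) h u :
    (forall a b, A a -> B b -> C (a + b)%N) ->
  supported A h -> supported B u -> supported C (h * u).
Proof. by move=> ABC Ah Bu n /fcoefM_neq0[i [j [-> /Ah Ai /Bu Bj]]]; apply: ABC. Qed.

Lemma fcoefM_eq h u u' n : (forall i, (i <= n)%N -> fcoef u i = fcoef u' i) ->
  fcoef (h * u) n = fcoef (h * u') n.
Proof. by move=> equ; apply: eq_bigr => i _; rewrite equ // leq_subr. Qed.

Lemma fcoefX_small h n j : fcoef h 0 = 0 -> (n < j)%N -> fcoef (h ^+ j) n = 0.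
Proof.
move=> h0; elim: j n => // j IHj n lt_nj; rewrite exprS fcoefM big1 // => i _.
have [->|i_gt0] := posnP i; first by rewrite h0 mul0r.
by rewrite IHj ?mulr0 //; move: lt_nj (ltn_ord i); lia.
Qed.

(** Geometric series in [u], the difference of 1 and [h] divided by its constant term: all powers of
    [u] have exponents in [A], hence so does the inverse. *)
Lemma fps_inverse (A : set nat) h : submonoid A -> supported A h ->
  fcoef h 0 != 0 -> exists2 w, supported A w & h * w = 1.
Proof.
move=> [A0 AD] Ah h0; pose u := 1 - fpsC (fcoef h 0)^-1 * h.
have Au : supported A u.
  apply: supportedD; first exact: (supportedX (n := 0%N)).
  by apply: supportedN; apply: supportedM Ah; [exact: AD | exact: supportedC].
have Auj j : supported A (u ^+ j).
  elim: j => [|j IHj]; first exact: (supportedX (n := 0%N)).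
  by rewrite exprS; apply: supportedM IHj; [exact: AD | exact: Au].
have u0 : fcoef u 0 = 0.
  by rewrite fcoefD fcoefN fcoef_Cmul mulVf // fcoef1 subrr.
pose W N := \sum_(j < N) u ^+ j.
have WS N : W N.+1 = W N + u ^+ N by rewrite /W big_ord_recr.
(* Powers beyond [u ^+ n] do not reach the coefficient at [n], so [W n.+1] is already exact
   there. *)
pose w := Fps (fun n => fcoef (W n.+1) n).
have wE n m : (n <= m)%N -> fcoef w n = fcoef (W m.+1) n.
  move=> /subnKC <- /=; elim: (m - n)%N => [|d IHd]; first by rewrite addn0.
  rewrite addnS [W (n + d).+2]WS fcoefD -IHd fcoefX_small ?addr0 //.
  by rewrite ltnS leq_addr.
exists (fpsC (fcoef h 0)^-1 * w).
  apply: (supportedM AD); first exact: supportedC.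
  by move=> n /=; apply: (supported_sum (A := A)).
have -> : h * (fpsC (fcoef h 0)^-1 * w) = (1 - u) * w.
  by rewrite /u opprB addrC subrK mulrCA mulrA.
apply: fpsP => n; rewrite (@fcoefM_eq _ _ (W n.+1)) => [|i le_in]; last exact: wE.
have -> : (1 - u) * W n.+1 = 1 - u ^+ n.+1.
  by rewrite -opprB mulNr -subrX1 opprB.
by rewrite fcoefD fcoefN fcoefX_small // subr0.
Qed.

(** A nonzero series is a power of [t] times a unit; so powers of [t] suffice as denominators. *)
Lemma fps_unit_part h : h != 0 -> exists n w, h * w = fpsX n.
Proof.
move=> nz_h; have [n nz_n small] := fps_ord (elimN eqP nz_h).
have [u uE] := fpsX_dvd small.
have u0 : fcoef u 0 != 0 by rewrite -(fcoef_Xmul_add n) addn0 -uE.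
have [||w _ uw1] := @fps_inverse (@classical_sets.setT nat) u _ _ u0.
- by split=> *; exact: I.
- by move=> *; exact: I.
by exists n, w; rewrite uE -mulrA uw1 mulr1.
Qed.

Lemma frac_fps (x : {fraction fps k}) : exists n h, x * (fpsX n)%:F = h%:F.
Proof.
have [u [v [/fps_unit_part[n [w vw]] xv]]] := frac_denom x.
by exists n, (u * w); rewrite -vw !tofracM mulrA xv.
Qed.

End PowerSeries.

(** * Separating a vector from a subspace *)

Section SeparatingFunctional.
Local Open Scope classical_set_scope.
Local Open Scope ring_scope.

Lemma separating_functional (k : fieldType) n (W : set 'rV[k]_n) (x : 'rV[k]_n) :
    W 0 -> (forall u v, W u -> W v -> W (u + v)) ->
    (forall c u, W u -> W (c *: u)) -> ~ W x ->
  exists l : 'cV[k]_n, (forall w, W w -> w *m l = 0) /\ x *m l != 0.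
Proof.
move=> W0 WD WZ nWx.
pose P r := `[< exists m (A : 'M[k]_(m, n)), (forall i, W (row i A)) /\ \rank A = r >].
have exP : exists r, P r.
  exists 0%N; apply/asboolP; exists 0%N, 0; split; [by case | exact: mxrank0].
have leP r : P r -> (r <= n)%N by move=> /asboolP[m [A [_ <-]]]; exact: rank_leq_col.
case: (ex_maxnP exP leP) => _ /asboolP[m [A [WA <-]]] maxA.
(* By maximality of the rank, the rows of [A] span [W]; a column of the cokernel matrix then gives
   the functional. *)
have subA w : W w -> (w <= A)%MS.
  move=> Ww; have sA : (A <= A + w)%MS by exact: addsmxSl.
  apply: submx_trans (addsmxSr A w) _; rewrite -(geq_leqif (mxrank_leqif_sup sA)).
  apply: maxA; apply/asboolP; exists (m + 1)%N, (col_mx A w).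
  split; last by rewrite -addsmxE.
  by move=> i; case: (split_ordP i) => j ->; rewrite ?rowKu ?rowKd ?row_id.
have [x_A|] := boolP (x <= A)%MS.
  case: nWx; have /submxP[D ->] := x_A; rewrite mulmx_sum_row.
  by elim/big_ind: _ => // i _; exact: WZ.
rewrite submxE => /rV0Pn[j nz_j]; exists (col j (cokermx A)); split=> [w /subA|].
  by rewrite submxE colE mulmxA => /eqP->; rewrite mul0mx.
rewrite colE mulmxA -colE; apply: contraNneq nz_j => /matrixP/(_ 0 0).
by rewrite !mxE => ->.
Qed.

End SeparatingFunctional.

(** * The local ring of a numerical semigroup *)

Section LocalRing.
Local Open Scope classical_set_scope.
Local Open Scope ring_scope.
Variables (k : fieldType) (S : set nat) (F : nat).
Hypothesis submonoid_S : submonoid S.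
Hypothesis nSF : ~ S F.
Hypothesis S_gtF : forall n, (F < n)%N -> S n.

Local Notation Q := {fraction fps k}.
Local Notation X n := (fpsX k n).
Implicit Types (h u w : fps k) (x y : Q) (A B C J : set nat).

Definition frac_supported A : set Q := [set h%:F | h in supported (k := k) A].

Local Notation R := (frac_supported S).
Local Notation S_pos := [set n | S n /\ n <> 0%N].

Let S0 : S 0%N := submonoid_S.1.
Let SD := submonoid_S.2.

Lemma frac_supportedP A h : frac_supported A h%:F <-> supported A h.
Proof.
split=> [[u Au /eqP]|Ah]; last by exists h.
by rewrite tofrac_eq => /eqP <-.
Qed.

Lemma frac_supportedM A B C x y :
    (forall a b, A a -> B b -> C (a + b)%N) ->
  frac_supported A x -> frac_supported B y -> frac_supported C (x * y).
Proof.
move=> ABC [h Ah <-] [u Bu <-]; rewrite -tofracM; apply/frac_supportedP.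
exact: supportedM ABC Ah Bu.
Qed.

Lemma frac_supportedX A n : frac_supported A (X n)%:F <-> A n.
Proof.
rewrite frac_supportedP; split=> [|An]; last exact: supportedX.
by apply; rewrite /= eqxx oner_neq0.
Qed.

Lemma frac_supportedW A B : A `<=` B -> frac_supported A `<=` frac_supported B.
Proof. by move=> AB _ [h Ah <-]; apply/frac_supportedP/(supportedW AB). Qed.

Lemma submodule_supported A :
  (forall s a, S s -> A a -> A (s + a)%N) -> submodule R (frac_supported A).
Proof.
move=> SA; split=> [|_ _ [h Ah <-] [u Au <-]|x y Rx Ay].
- by rewrite -tofrac0; apply/frac_supportedP; apply: supported0.
- by rewrite -tofracD; apply/frac_supportedP; apply: supportedD.
- exact: frac_supportedM SA Rx Ay.
Qed.

(** By [fps_inverse], a series with exponents in [S] and nonzero constant term has its inverse in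
    [R]. *)
Lemma nonunits_supported : nonunits R = frac_supported S_pos.
Proof.
apply/seteqP; split=> [_ [[h Sh <-] no_inv]|_ [h Mh <-]].
  apply/frac_supportedP => n nz_n; split; first exact: Sh.
  move=> n0; rewrite n0 in nz_n; have [w Sw hw1] := fps_inverse submonoid_S Sh nz_n.
  by apply: no_inv; exists w%:F; [exact/frac_supportedP | rewrite -tofracM hw1 tofrac1].
split; first by apply/frac_supportedP => n /Mh[].
move=> [_ [u _ <-]] /eqP; rewrite -tofracM -tofrac1 tofrac_eq.
move=> /eqP/(congr1 (fun h => fcoef h 0%N)).
rewrite fcoefM big_ord1 fcoef1 /= => /eqP; apply/negP.
have [->|/Mh[_ //]] := eqVneq (fcoef h 0%N) 0.
by rewrite mul0r eq_sym oner_neq0.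
Qed.

(** The union of [S] and its pseudo-Frobenius numbers. *)
Definition pf_closure : set nat :=
  [set n | forall s, S s -> s <> 0%N -> S (n + s)%N].

Lemma colon_nonunits : colon R (nonunits R) = frac_supported pf_closure.
Proof.
rewrite nonunits_supported; apply/seteqP; split=> [x colon_x|x Tx y My]; last first.
  by apply: frac_supportedM Tx My => a b Ta []; exact: Ta.
have [n [h xh]] := frac_fps x.
have xX s : S s -> s <> 0%N -> exists2 u, supported S u & X s * h = X n * u.
  move=> Ss s0; have [|u Su] := colon_x (X s)%:F; first exact/frac_supportedX.
  move=> ux; exists u => //; apply/eqP; rewrite -tofrac_eq !tofracM -xh ux.
  by rewrite mulrCA [eqbRHS]mulrC -mulrA.
(* For [i < n], the choice [s = F + (n - i)] makes the coefficient of [h] at [i] that of [u] at [F],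
   which is 0. So [x] is a power series. *)
have [|w hE] := @fpsX_dvd k n h.
  move=> i lt_in; have [||u Su] := xX (F + (n - i))%N; [apply: S_gtF; lia|lia|].
  move=> /(congr1 (fun h => fcoef h (n + F)%N)).
  rewrite fcoef_Xmul_add; have -> : (n + F = F + (n - i) + i)%N by lia.
  rewrite fcoef_Xmul_add => ->; apply/eqP/negP => /negP/Su; exact: nSF.
have -> : x = w%:F.
  apply: (@mulIf _ (X n)%:F); first by rewrite tofrac_eq0 fpsX_neq0.
  by rewrite xh hE tofracM mulrC.
apply/frac_supportedP => m nz_m s Ss s0; have [u Su] := xX s Ss s0.
rewrite hE mulrCA => /mulfI -/(_ (fpsX_neq0 k n)) sw.
by apply: Su; rewrite -sw addnC fcoef_Xmul_add.
Qed.

(** [F - n] is not in [S], put additively so that it holds for all [n > F], where truncated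
    subtraction would give 0. *)
Definition canonical_exponents : set nat :=
  [set n | forall s, S s -> (n + s)%N <> F].

Local Notation K := (frac_supported canonical_exponents).

Lemma fractional_ideal_canonical : fractional_ideal R K.
Proof.
split.
- apply: submodule_supported => s a Ss Ka t St; rewrite addnAC addnC.
  by apply: Ka; apply: SD.
- exists 1; last exact: oner_neq0.
  rewrite -tofrac1; apply/(frac_supportedX _ 0%N) => s Ss; rewrite add0n => sF.
  by apply: nSF; rewrite -sF.
- exists (X F.+1)%:F; first split.
  + by apply/frac_supportedX/S_gtF.
  + by rewrite tofrac_eq0 fpsX_neq0.
  move=> _ [h _ <-]; rewrite -tofracM; apply/frac_supportedP => n.
  by rewrite fcoef_Xmul; case: ltnP => [|/S_gtF//]; rewrite eqxx.
Qed.


(* [y] is in [K : J] iff the coefficient of [t ^ F] vanishes on [y * J], so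
   reflexivity is biduality of finite-dimensional spaces, [J] containing all
   series of large order. *)
Lemma canonical_ideal_supported : canonical_ideal R K.
Proof.
split=> [|J [[J0 JD JZ] [z Jz nz_z] [d [Rd nz_d] dJ]]].
  exact: fractional_ideal_canonical.
apply/seteqP; split=> [x KKx|x Jx y Ky]; last by rewrite mulrC; apply: Ky.
apply: contrapT => nJx.
have [m [h0 xh0]] := frac_fps x.
have [d' _ def_d] := Rd; rewrite -def_d tofrac_eq0 in nz_d.
have [m' [w d'w]] := fps_unit_part nz_d.
pose N := (m + m')%N.
have xN : exists h, x * (X N)%:F = h%:F.
  by exists (h0 * X m'); rewrite fpsXD tofracM mulrA xh0 tofracM.
have JN y : J y -> exists h, y * (X N)%:F = h%:F.
  move=> /dJ[h _]; rewrite -def_d => hE; exists (h * w * X m).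
  rewrite /N addnC fpsXD -d'w !tofracM hE.
  by rewrite !mulrA [y * _]mulrC.
have nzX n : (X n)%:F != 0 :> Q by rewrite tofrac_eq0 fpsX_neq0.
pose JX : set (fps k) := [set h | J (h%:F / (X N)%:F)].
have JXD h u : JX h -> JX u -> JX (h + u).
  by rewrite /JX /= tofracD mulrDl; exact: JD.
have JXZ h u : supported S h -> JX u -> JX (h * u).
  by move=> Sh Ju; rewrite /JX /= tofracM -mulrA; apply: JZ => //; apply/frac_supportedP.
have JXC a h : JX h -> JX (fpsC a * h) by apply: JXZ; apply: supportedC.
(* A nonzero [z] in [J] yields a power of [t] up to a unit, and [R] contains every series of order
   above [F]. *)
have [c leFc JXc] : exists2 c, (F < c)%N &
    forall h, (forall i, (i < c)%N -> fcoef h i = 0) -> JX h.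
  have [hz zN] := JN z Jz.
  have nz_hz : hz != 0 by rewrite -tofrac_eq0 -zN mulf_neq0.
  have [n [w' hzw']] := fps_unit_part nz_hz.
  exists (n + F.+1)%N; first lia.
  move=> h /fpsX_dvd[u ->]; rewrite fpsXD -hzw'.
  have -> : hz * w' * X F.+1 * u = X F.+1 * (w' * u) * hz.
    by rewrite -!mulrA mulrC -!mulrA mulrCA.
  apply: JXZ; last by rewrite /JX /= -zN mulfK.
  move=> i; rewrite fcoef_Xmul; case: ltnP => [|/S_gtF//]; by rewrite eqxx.
have [hx xhx] := xN.
have nJXx : ~ JX hx by rewrite /JX /= -xhx mulfK.
pose trunc h : 'rV[k]_c := \row_i fcoef h i.
have [||||l [l0 lx]] := @separating_functional k c [set trunc h | h in JX] (trunc hx).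
- exists 0; last by apply/rowP => i; rewrite !mxE.
  by rewrite /JX /= tofrac0 mul0r.
- move=> _ _ [h Jh <-] [u Ju <-]; exists (h + u); first exact: JXD.
  by apply/rowP => i; rewrite !mxE.
- move=> a _ [h Jh <-]; exists (fpsC a * h); first exact: JXC.
  by apply/rowP => i; rewrite !mxE fcoef_Cmul.
- move=> [h Jh eq_h]; apply: nJXx.
  have -> : hx = h + (hx - h) by rewrite addrC subrK.
  apply: JXD => //; apply: JXc => i lt_ic.
  have /rowP/(_ (Ordinal lt_ic)) := eq_h; rewrite !mxE fcoefD fcoefN /= => ->.
  exact: subrr.
(* [ell] represents the functional [l]: the coefficient of [t ^ c] in [ell * h]
   is the value of [l] on the truncation of [h]. *)
pose ell := \sum_(i < c) fpsC (l i 0) * X (c - i).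
have ellE h : fcoef (ell * h) c = (trunc h *m l) 0 0.
  rewrite mulr_suml fcoef_sum mxE; apply: eq_bigr => i _.
  rewrite -mulrA fcoef_Cmul fcoef_Xmul mxE mulrC ltnNge leq_subr /=.
  by rewrite subKn // ltnW.
have ell_J h : JX h -> fcoef (ell * h) c = 0.
  by move=> Jh; rewrite ellE l0 ?mxE //; exists h.
have ell_low h s : JX h -> S s -> (s <= c)%N -> fcoef (ell * h) (c - s) = 0.
  move=> Jh Ss le_sc; rewrite -(fcoef_Xmul_add s) subnKC // mulrCA.
  by apply: ell_J; apply: JXZ => //; apply: supportedX.
(* For [h = x' * t ^ N], this shift makes the coefficient of [t ^ c] in [ell * h] that of [t ^ F] in
   [y * x']. *)
pose y : Q := ell%:F * (X F)%:F * (X N)%:F / (X c)%:F.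
have yE x' h : x' * (X N)%:F = h%:F -> y * x' * (X c)%:F = (ell * h * X F)%:F.
  move=> xh; rewrite /y mulrAC mulfVK // !tofracM -xh -!mulrA; congr (_ * _).
  by rewrite mulrC [_ * x']mulrC mulrA.
have Ky : colon K J y.
  move=> x' Jx'; have [h xh] := JN x' Jx'.
  have Jh : JX h by rewrite /JX /= -xh mulfK.
  have [|u ellh] := @fpsX_dvd k (c - F) (ell * h).
    move=> i lt_i; have -> : i = (c - (c - i))%N by lia.
    by apply: ell_low => //; [apply: S_gtF; lia | lia].
  have -> : y * x' = u%:F.
    apply: (mulIf (nzX c)); rewrite (yE _ _ xh) ellh.
    by rewrite mulrAC -fpsXD subnK 1?ltnW // tofracM mulrC.
  apply/frac_supportedP => i nz_i s Ss eqF; case/eqP: nz_i.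
  rewrite -(fcoef_Xmul_add (c - F)) -ellh.
  have -> : (c - F + i = c - s)%N by lia.
  by apply: ell_low => //; lia.
(* [F] is not an exponent of [K], so the coefficient of [t ^ F] in [x * y], which is the value of
   [l] on [trunc hx], vanishes. *)
have [u Ku ux] := KKx y Ky.
have : (ell * hx * X F)%:F = (u * X c)%:F.
  by rewrite -(yE _ _ xhx) tofracM ux [x * y]mulrC.
move=> /eqP; rewrite tofrac_eq => /eqP/(congr1 (fun h => fcoef h (c + F)%N)).
rewrite [u * _]mulrC fcoef_Xmul_add [_ * X F]mulrC addnC fcoef_Xmul_add ellE.
move=> eq_l; apply: (Ku F _ 0%N S0); last exact: addn0.
rewrite -eq_l; apply: contraNneq lx => l00.
by apply/eqP/rowP => i; rewrite ord1 l00 mxE.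
Qed.

(** The defining inclusion for the canonical ideal [K], tested on the product of [t ^ s] and
    [t ^ n]. *)
Lemma almost_gorenstein_exponents : almost_gorenstein R (fps_ring k) ->
  forall n s, (forall t, S t -> (n + t)%N <> F) -> S s -> s <> 0%N -> S (n + s)%N.
Proof.
move=> AG n s Kn Ss s0; apply/frac_supportedX.
rewrite addnC fpsXD tofracM.
have [] // := AG _ canonical_ideal_supported _ _ (X s)%:F (X n)%:F.
- apply: frac_supportedW => a Sa t St aF; apply: nSF; rewrite -aF; exact: SD.
- by move=> _ [h _ <-]; exists h.
- by rewrite nonunits_supported; apply/frac_supportedX.
- exact/frac_supportedX.
Qed.

(** For a parameter [u] and [m] the maximal ideal, division by [u] turns the socle of [R / uR] into
    [(R : m) / R], with basis the [t ^ f] for [f] in [s]. *)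
Lemma cm_type_pf (s : seq nat) : uniq s ->
  (forall n, n \in s <-> ~ S n /\ pf_closure n) -> cm_type R (size s).
Proof.
move=> uniq_s sP x Mx.
have [u Mu <-] : frac_supported S_pos x by rewrite -nonunits_supported.
move=> nz_u {x Mx}.
pose f i := nth 0%N s i.
have f_s (i : 'I_(size s)) : f i \in s by exact: mem_nth.
exists (fun i => u%:F * (X (f i))%:F); split.
- move=> i; have [_ Tfi] := (sP _).1 (f_s i); split.
    rewrite -tofracM; apply/frac_supportedP.
    apply: (supportedM _ Mu (@supportedX k (eq (f i)) _ erefl)) => a b [Sa a0] <-.
    by rewrite addnC; apply: Tfi.
  rewrite nonunits_supported => y My; exists ((X (f i))%:F * y); last by rewrite mulrA.
  apply: frac_supportedM _ ((frac_supportedX (eq (f i)) _).2 erefl) My.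
  by move=> a b <- [Sb b0]; apply: Tfi.
(* Removing from [y / u] its terms at pseudo-Frobenius numbers leaves exponents in [S]. *)
- move=> y [_ Vy].
  have : colon R (nonunits R) (y / u%:F).
    by move=> t /Vy[r Rr ur]; rewrite mulrAC -ur mulrAC mulfV // mul1r.
  rewrite colon_nonunits => -[h Th yh].
  exists (fun i => (fpsC (fcoef h (f i)))%:F); split.
    by move=> i; apply/frac_supportedP; apply: supportedC.
  pose w := h - \sum_(i < size s) fpsC (fcoef h (f i)) * X (f i).
  exists w%:F; last first.
    rewrite tofracB rmorph_sum mulrBr yh mulrC divfK //; congr (_ - _).
    rewrite mulr_sumr; apply: eq_bigr => i _.
    by rewrite rmorphM mulrCA.
  apply/frac_supportedP => n nz_n; apply: contrapT => nSn; case/eqP: nz_n.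
  rewrite fcoefD fcoefN fcoef_sum.
  have -> : \sum_(i < size s) fcoef (fpsC (fcoef h (f i)) * X (f i)) n =
      \sum_(j <- s) fcoef h n * (n == j)%:R.
    rewrite (big_nth 0%N) big_mkord; apply: eq_bigr => i _.
    by rewrite fcoef_Cmul /=; case: eqP => [->|]; rewrite ?mulr0.
  have [->|nz_n] := eqVneq (fcoef h n) 0.
    by rewrite big1 ?subr0 // => j _; rewrite mul0r.
  have sn : n \in s by apply/sP; split=> //; exact: Th.
  rewrite (bigD1_seq n) //= eqxx mulr1 big1 ?addr0 ?subrr // => j /negPf.
  by rewrite eq_sym => ->; rewrite mulr0.
(* At the gap [f j], only the constant term of [q j] contributes: a nonzero [f j - f i] in [S] would
   put [f j] in [S]. *)
- move=> r Rr [_ [a Sa <-] ua].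
  have {}Rr i : {h | supported S h & r i = h%:F}.
    by have /cid2[h Sh rh] := Rr i; exists h.
  pose q i := s2val (Rr i).
  have qE i : r i = (q i)%:F by exact: s2valP' (Rr i).
  have Sq i : supported S (q i) by exact: s2valP (Rr i).
  have {ua} aE : a = \sum_(i < size s) X (f i) * q i.
    apply/eqP; rewrite -tofrac_eq rmorph_sum; apply/eqP/(mulfI nz_u).
    rewrite ua mulr_sumr; apply: eq_bigr => i _.
    by rewrite qE rmorphM mulrC -mulrA.
  move=> j; rewrite nonunits_supported qE; apply/frac_supportedP => n nz_n.
  split=> [|n0]; first exact: Sq nz_n.
  have [nSj _] := (sP _).1 (f_s j); apply: nSj; apply: Sa.
  rewrite aE fcoef_sum (bigD1 j) // big1 => [|i ne_ij].
    by rewrite fcoef_Xmul0 /= addr0; rewrite n0 in nz_n.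
  rewrite fcoef_Xmul; case: ltnP => // le_ij; apply/eqP/negP => /negP/Sq Sd.
  have [nSj Tfi] := (sP _).1 (f_s j); have [_ {}Tfi] := (sP _).1 (f_s i).
  apply: nSj; rewrite -(subnKC le_ij); apply: Tfi => // /eqP.
  rewrite subn_eq0 => le_ji; case/eqP: ne_ij; apply: val_inj => /=.
  by apply/eqP; rewrite -(nth_uniq 0%N _ _ uniq_s) // eqn_leq; apply/andP.
Qed.

End LocalRing.

(** * From the curve to its semigroup *)

Section CurveExponents.
Local Open Scope classical_set_scope.
Variables (e : nat) (g : 'I_e -> nat).
Local Notation S := (semigroup g).

Lemma submonoid_generated G : submonoid (generated G).
Proof.
split=> [A [[A0 _] _]|a b Ga Gb A AP]; first by [].
by have [[_ AD] _] := AP; apply: AD; [apply: Ga | apply: Gb].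
Qed.

Lemma submonoid_semigroup : submonoid S.
Proof. split; [exact: semigroup0 | exact: semigroupD]. Qed.

Lemma generated_range : generated (range g) = S.
Proof.
apply/seteqP; split.
  apply: smallest_sub; first exact: submonoid_semigroup.
  by move=> _ [i _ <-]; exact: semigroup_gen.
move=> _ [a ->]; have [G0 GD] := submonoid_generated (range g).
rewrite /combination; elim/big_ind: _ => // i _.
elim: (a i) => [|m IHm]; first by rewrite mul0n.
by rewrite mulSn; apply: GD IHm; apply: sub_gen_smallest; exists i.
Qed.

Hypothesis g_curve : monomial_curve_exponents g.

(** 0 lies in every submonoid, so a minimal generating set omits it. *)
Lemma exponents_gt0 i : 0 < g i.
Proof.
have [_ [T [_ [defT minT]]]] := g_curve; rewrite lt0n; apply/eqP => gi0.
suff defG : range g `\ 0 = range g.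
  have [_] : (range g `\ 0) 0 by rewrite defG; exists i.
  by apply.
apply: minT; first by move=> n [].
rewrite -defT; apply/seteqP; split; apply: smallest_sub; try exact: submonoid_generated.
  by move=> n [Gn _]; exact: sub_gen_smallest.
move=> n Gn; have [->|/eqP n0] := eqVneq n 0.
  by case: (submonoid_generated (range g `\ 0)).
by apply: sub_gen_smallest; split.
Qed.

Lemma finite_gaps : finite_set (~` S).
Proof. by have [_ [T [[_ finT] [defT _]]]] := g_curve; rewrite -generated_range defT. Qed.

(** Otherwise 1 alone generates, and minimality leaves a single exponent. This ensures a gap, hence
    a Frobenius number in [nat]. *)
Lemma semigroup1 : 1 < e -> ~ S 1.
Proof.
move=> e_gt1 S1; have [inj_g [T [_ [defT minT]]]] := g_curve.
have [i gi1] : exists i, g i = 1.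
  have [a a1] := S1; have [i ai|/= a0] := pickP (fun i => 0 < a i).
    exists i; have := @combination_split _ g a i ai; rewrite -a1 => -[s _].
    by have := exponents_gt0 i; lia.
  move: a1; rewrite /combination big1 // => i _.
  by have := a0 i; case: (a i).
have all_gen U n : submonoid U -> U 1 -> U n.
  move=> [U0 UD] U1; elim: n => // n IHn; rewrite -addn1; exact: UD.
have defG : [set 1] = range g.
  apply: minT; first by move=> _ ->; exists i.
  rewrite -defT generated_range; apply/seteqP; split=> n _.
    exact: all_gen submonoid_semigroup S1.
  apply: (all_gen (generated [set 1]) _ (submonoid_generated _)).
  exact: sub_gen_smallest.
have g1 j : g j = 1 by have : (range g) (g j) by []; rewrite -defG.
have := inj_g (Ordinal (ltnW e_gt1)) (Ordinal e_gt1); rewrite !g1.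
by move=> /(_ erefl)/(congr1 val).
Qed.

Lemma frobenius_exists : 1 < e -> exists F, ~ S F /\ forall n, F < n -> S n.
Proof.
move=> e_gt1; pose P n := `[< ~ S n >].
have [s gapsE] := (finite_seqP _).1 finite_gaps.
have exP : exists n, P n by exists 1; apply/asboolP/semigroup1.
have leP n : P n -> n <= \max_(m <- s) m.
  move=> /asboolP nSn; have : (~` S) n by [].
  rewrite gapsE /= => sn; exact: (@leq_bigmax_seq _ s xpredT id).
case: (ex_maxnP exP leP) => F /asboolP nSF maxF; exists F; split=> // n lt_Fn.
apply: contrapT => /asboolP/maxF; lia.
Qed.

Lemma curve_ring_supported (k : fieldType) :
  curve_ring k g = frac_supported (k := k) S.
Proof.
apply/seteqP; split=> [_ [c _ <-]|_ [h Sh <-]].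
  apply/frac_supportedP => n /=; apply: contraNP => nSn.
  rewrite big_pred0 // => a; apply/eqP => sum_a; apply: nSn.
  by exists (fun i => nat_of_ord (a i)).
have [fac facE] := factorization_exists g.
(* The coefficient of [t ^ n] sits on the chosen factorization of [n] alone, so the substitution sum
   has at most one nonzero term. *)
pose c (a : 'I_e -> nat) : k :=
  if `[< a = fac (combination g a) >] then fcoef h (combination g a) else 0%R.
exists c => //; congr FracField.tofrac; apply: fpsP => n /=.
have cE (a : {ffun 'I_e -> 'I_n.+1}) : (\sum_i a i * g i)%N == n ->
    c (fun i => nat_of_ord (a i)) =
    if `[< (fun i => nat_of_ord (a i)) = fac n >] then fcoef h n else 0%R.
  by rewrite /c /combination => /eqP->.
have [hn0|/Sh Sn] := eqVneq (fcoef h n) 0%R.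
  by rewrite hn0 big1 // => a /cE->; rewrite hn0 if_same.
have fac_le i : fac n i < n.+1.
  rewrite ltnS [leqRHS](facE n Sn) /combination (bigD1 i) //=.
  by rewrite -[leqLHS]muln1 (leq_trans _ (leq_addr _ _)) // leq_mul2l exponents_gt0 orbT.
pose a0 : {ffun 'I_e -> 'I_n.+1} := [ffun i => Ordinal (fac_le i)].
have a0E : (fun i => nat_of_ord (a0 i)) = fac n.
  by apply: funext => i; rewrite ffunE.
have sum_a0 : (\sum_i a0 i * g i)%N == n.
  rewrite [eqbRHS](facE n Sn); apply/eqP/eq_bigr => i _.
  by rewrite -a0E.
rewrite (bigD1 a0) //= big1 ?GRing.addr0 => [|a /andP[sum_a ne_a]].
  by rewrite cE // a0E asboolT.
rewrite cE //; case: asboolP => // aE; case/eqP: ne_a.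
apply/ffunP => i; apply: val_inj; rewrite /= -[RHS]/((fun i => nat_of_ord (a0 i)) i).
by rewrite a0E -aE.
Qed.

End CurveExponents.

Theorem theorem2 :
  exists M : nat, forall (k : fieldType) (g : 'I_5 -> nat),
    monomial_curve_exponents g ->
    almost_gorenstein (curve_ring k g) (fps_ring k) ->
    exists2 t : nat, cm_type (curve_ring k g) t & t <= M.
Proof.
have [M boundM] := almost_symmetric_type_bounded.
(* The extra 1 is for [F] itself, as [F - F = 0] lies in the semigroup. *)
exists M.+1 => k g g_curve; rewrite (curve_ring_supported g_curve k) => AG.
have [F [nSF S_gtF]] := frobenius_exists g_curve isT.
have subS := submonoid_semigroup g.
pose isPF n := `[< ~ semigroup g n /\ pf_closure (semigroup g) n >].
exists (size [seq n <- iota 0 F.+1 | isPF n]).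
  apply: (cm_type_pf subS nSF S_gtF); first by rewrite filter_uniq ?iota_uniq.
  move=> n; rewrite mem_filter mem_iota leq0n add0n; split=> [/andP[/asboolP]//|PFn].
  apply/andP; split; first exact/asboolP.
  by rewrite ltnS leqNgt; apply/negP => /S_gtF; case: PFn.
have -> : iota 0 F.+1 = iota 0 F ++ [:: F] by rewrite -addn1 iotaD.
rewrite filter_cat size_cat -[M.+1]addn1 leq_add //; last by rewrite size_filter count_size.
apply: (boundM g F _ _ nSF); first exact: exponents_gt0.
  by rewrite sorted_filter ?iota_ltn_sorted //; exact: ltn_trans.
move=> f; rewrite mem_filter mem_iota add0n => /andP[/asboolP[nSf PFf] /= lt_fF].
have nSf' : ~ semigroup g (F - f).
  move=> Sf'; apply: nSF; rewrite -(subnKC (ltnW lt_fF)).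
  by apply: PFf Sf' _; lia.
split=> //; [exact: ltnW | split=> // s Ss s0].
(* [F - f] is a canonical exponent because [f] is a gap. *)
apply: (almost_gorenstein_exponents subS nSF S_gtF AG) => // t St eqF.
by apply: nSf; have <- : t = f by lia.
Qed.
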